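(* Suppose $Q$ is a pentaform and $t\in T$, where $T$ is the set of (Selten) subroots of $Q$. Then ${}^tQ$ is a pentaform.
   Context: A quintuple $\langle i,j,w,a,y\rangle$ has arbitrary objects as components, called player, situation, decision node, action, successor node. Decision nodes and successor nodes are both nodes (the same object may occur as both). A quintuple set $Q$ is a (possibly infinite) set of quintuples. For a string of letters from $I,J,W,A,Y$, $\pi_{\cdots}(Q)$ is the projection of $Q$ onto those coordinates, in the order listed, e.g. $\pi_{JI}(Q)=\{\langle j,i\rangle\mid \exists w,a,y:\ \langle i,j,w,a,y\rangle\in Q\}$. Write $J=\pi_J(Q)$, $W=\pi_W(Q)$, $Y=\pi_Y(Q)$. For $j\in J$, the slice is $Q_j=\{\langle i_*,j_*,w_*,a_*,y_*\rangle\in Q\mid j_*=j\}$. A function is a set $f$ of couples such that $\langle x,z\rangle,\langle x,z'\rangle\in f$ implies $z=z'$. A pentaform is a quintuple set $Q$ such that: [Pij] $\pi_{JI}(Q)$ is a function; [Pjw] $\pi_{WJ}(Q)$ is a function; [Pwa] for all $j\in J$, $\pi_{WA}(Q_j)$ is a Cartesian product; [Pway] $\{\langle\langle w,a\rangle,y\rangle\mid\langle w,a,y\rangle\in\pi_{WAY}(Q)\}$ is a function; [Pwy] $\pi_{YW}(Q)$ is a function, denoted $p$; [Pay] $\pi_{YA}(Q)$ is a function; [Py] for every $y\in Y$ there is $m\ge1$ with $p^m(y)\notin Y$ (iterates of $p$ from $y$ eventually leave $Y$); [Pr] $W\smallsetminus Y$ is a singleton. For a pentaform $Q$, the weak precedence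 order $\preccurlyeq$ on $W\cup Y$ is defined by: $x\preccurlyeq y$ iff there is a finite sequence $\langle x_0,\dots,x_m\rangle$ ($m\ge0$) in $W\cup Y$ with $x_0=x$, $x_m=y$ and $\langle x_\ell,x_{\ell+1}\rangle\in\pi_{WY}(Q)$ for all $\ell<m$. For $w\in W$, let ${}^wQ=\{\langle i_*,j_*,w_*,a_*,y_*\rangle\in Q\mid w\preccurlyeq w_*\}$ and ${}^wJ=\pi_J({}^wQ)$. The set of (Selten) subroots is $T=\{t\in W\mid {}^tJ\text{ and }\pi_J(Q\smallsetminus{}^tQ)\text{ are disjoint}\}$. *)

(* Defs.v *)
From mathcomp Require Import all_boot.
From mathcomp Require Import boolp classical_sets.

Set Implicit Arguments.
Unset Strict Implicit.
Unset Printing Implicit Defensive.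

Local Open Scope classical_set_scope.

(* The components are arbitrary objects, hence the arbitrary types. Decision
   nodes and successor nodes share the type X, since the same object may occur
   as both; objects from the other coordinates are never compared. *)
Record quintuple (I J X A : Type) : Type := Quintuple {
  player : I;
  situation : J;
  decision_node : X;
  action : A;
  successor_node : X }.

Definition is_function (S T : Type) (f : set (S * T)) : Prop :=
  forall x z z', f (x, z) -> f (x, z') -> z = z'.

Definition is_cartesian (S T : Type) (f : set (S * T)) : Prop :=
  exists (B : set S) (C : set T), f = B `*` C.

Definition is_singleton (T : Type) (B : set T) : Prop := exists r, B = [set r].

(* The graph of the m-th iterate of f, as a partial function: fun_iter f m
   relates y to x when the m-th iterate is defined at y and equal to x there. *)
Fixpoint fun_iter (X : Type) (f : set (X * X)) (m : nat) : set (X * X) :=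
  match m with
  | 0 => [set yx | yx.2 = yx.1]
  | m'.+1 => [set yx | exists z, fun_iter f m' (yx.1, z) /\ f (z, yx.2)]
  end.

Section Pentaform.
Variables I J X A : Type.
Implicit Type Q : set (quintuple I J X A).

Definition pi_J Q : set J := [set situation q | q in Q].
Definition pi_W Q : set X := [set decision_node q | q in Q].
Definition pi_Y Q : set X := [set successor_node q | q in Q].
Definition pi_JI Q : set (J * I) := [set (situation q, player q) | q in Q].
Definition pi_WJ Q : set (X * J) :=
  [set (decision_node q, situation q) | q in Q].
Definition pi_WA Q : set (X * A) := [set (decision_node q, action q) | q in Q].
Definition pi_WY Q : set (X * X) :=
  [set (decision_node q, successor_node q) | q in Q].
Definition pi_YW Q : set (X * X) :=
  [set (successor_node q, decision_node q) | q in Q].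
Definition pi_YA Q : set (X * A) :=
  [set (successor_node q, action q) | q in Q].
(* (X * A * X) is ((X * A) * X). *)
Definition pi_WAY Q : set (X * A * X) :=
  [set (decision_node q, action q, successor_node q) | q in Q].

Definition slice Q (j : J) : set (quintuple I J X A) :=
  Q `&` [set q | situation q = j].

Record pentaform Q : Prop := {
  Pij : is_function (pi_JI Q);
  Pjw : is_function (pi_WJ Q);
  Pwa : forall j, pi_J Q j -> is_cartesian (pi_WA (slice Q j));
  Pway : is_function (pi_WAY Q);
  Pwy : is_function (pi_YW Q);
  Pay : is_function (pi_YA Q);
  Py : forall y, pi_Y Q y ->
    exists m x, [/\ (1 <= m)%N, fun_iter (pi_YW Q) m (y, x) & ~ pi_Y Q x];
  Pr : is_singleton (pi_W Q `\` pi_Y Q) }.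

(* Only the values s 0, ..., s m of s matter: s encodes the sequence
   (s 0, ..., s m). *)
Definition weak_prec Q (x y : X) : Prop :=
  exists (m : nat) (s : nat -> X),
    [/\ forall l, (l <= m)%N -> (pi_W Q `|` pi_Y Q) (s l),
        s 0%N = x, s m = y &
        forall l, (l < m)%N -> pi_WY Q (s l, s l.+1)].

Definition quintuples_from Q (w : X) : set (quintuple I J X A) :=
  Q `&` [set q | weak_prec Q w (decision_node q)].

Definition subroots Q : set X :=
  [set t | pi_W Q t /\
    pi_J (quintuples_from Q t) `&` pi_J (Q `\` quintuples_from Q t) = set0].

End Pentaform.

(* Main.v *)
(* Every property except [Pwa], [Py] and [Pr] passes to subsets. [Pwa] survives
   because the subroot condition makes each slice of [quintuples_from Q t] a
   slice of [Q]. [Py] survives because the predecessor maps of [Q] and of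
   [quintuples_from Q t] agree as long as the latter is defined. For [Pr], a
   node other than [t] that weakly follows [t] is a successor in
   [quintuples_from Q t], so only [t] can be a root; and if [t] were itself such
   a successor, it would lie on a cycle, and its iterated predecessors would
   never leave [pi_Y Q]. *)
Require Import Defs.
From mathcomp Require Import all_boot.
From mathcomp Require Import boolp classical_sets.

Set Implicit Arguments.
Unset Strict Implicit.
Unset Printing Implicit Defensive.

Local Open Scope classical_set_scope.

Lemma is_function_subset (S T : Type) (f g : set (S * T)) :
  f `<=` g -> is_function g -> is_function f.
Proof. by move=> fg gfun x z z' /fg ? /fg; exact: gfun. Qed.

Section QuintuplesFrom.
Variables (I J X A : Type) (Q : set (quintuple I J X A)).

Lemma weak_prec_refl x : (pi_W Q `|` pi_Y Q) x -> weak_prec Q x x.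
Proof. by move=> WYx; exists 0, (fun=> x). Qed.

Lemma weak_prec_last x y : weak_prec Q x y ->
  x = y \/ exists2 z, weak_prec Q x z & pi_WY Q (z, y).
Proof.
move=> [[|m] [s [sWY s0 sm step]]]; first by left; rewrite -s0 -sm.
right; exists (s m); last by rewrite -sm; exact: step.
exists m, s; split => // l lm; first exact/sWY/leqW.
exact/step/ltnW.
Qed.

Variable t : X.

Lemma quintuples_from_subset : quintuples_from Q t `<=` Q.
Proof. by move=> q []. Qed.

Lemma pi_Y_quintuples_from_subset : pi_Y (quintuples_from Q t) `<=` pi_Y Q.
Proof. exact/image_subset/quintuples_from_subset. Qed.

Lemma pi_W_quintuples_from_root : pi_W Q t -> pi_W (quintuples_from Q t) t.
Proof.
move=> Wt; case: (Wt) => q Qq qt; exists q => //.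
by split=> //=; rewrite qt; apply: weak_prec_refl; left.
Qed.

(** The last step of a nonconstant chain from [t] comes from a quintuple whose decision node still
    follows [t]. *)
Lemma weak_prec_pi_Y_quintuples_from y : weak_prec Q t y ->
  t = y \/ pi_Y (quintuples_from Q t) y.
Proof.
move=> /weak_prec_last[->|[z tz [q Qq [qz qy]]]]; first by left.
by right; exists q => //; split=> //=; rewrite qz.
Qed.

(** A quintuple of [slice Q j] outside [quintuples_from Q t] would put [j] in both of the disjoint
    sets of situations. *)
Lemma slice_quintuples_from j : subroots Q t ->
  pi_J (quintuples_from Q t) j ->
  slice (quintuples_from Q t) j = slice Q j.
Proof.
move=> [_ disj] Jj; apply/seteqP; split=> q [Qq qj]; split=> //.
  exact: quintuples_from_subset.
apply: contrapT => nq.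
suff : set0 j by [].
by rewrite -disj; split=> //; exists q.
Qed.

(** [y] already has a predecessor in the smaller set, and by uniqueness in [Q] it is [w]. *)
Lemma pi_YW_quintuples_from y w : is_function (pi_YW Q) ->
  pi_Y (quintuples_from Q t) y -> pi_YW Q (y, w) ->
  pi_YW (quintuples_from Q t) (y, w).
Proof.
move=> pfun [q Tq qy] yw; exists q => //; congr pair => //.
apply: pfun yw; rewrite -qy.
by exists q => //; exact: quintuples_from_subset.
Qed.

(** Either the backward path never leaves the successors of the smaller set before its last step, or
    its first exit [z] is what [Py] asks for. *)
Lemma fun_iter_quintuples_from m y x : is_function (pi_YW Q) ->
  pi_Y (quintuples_from Q t) y -> fun_iter (pi_YW Q) m (y, x) ->
  fun_iter (pi_YW (quintuples_from Q t)) m (y, x) \/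
  exists k z, [/\ 1 <= k, fun_iter (pi_YW (quintuples_from Q t)) k (y, z)
                & ~ pi_Y (quintuples_from Q t) z].
Proof.
move=> pfun Yy; elim: m x => [|m IH] x /=; first by left.
move=> [z [/IH[yz|] zx]]; last by right.
have [Yz|nYz] := pselect (pi_Y (quintuples_from Q t) z).
  by left; exists z; split=> //; exact: pi_YW_quintuples_from.
(* The exit index is positive: at index 0 the node is [y] itself, a successor by [Yy]. *)
right; case: m {IH} yz => [zy|m yz]; last by exists m.+1, z.
by case: nYz; move: zy => /= ->.
Qed.

Lemma root_not_pi_Y_quintuples_from : pentaform Q -> ~ pi_Y (quintuples_from Q t) t.
Proof.
move=> hQ YTt.
have YQ y : weak_prec Q t y -> pi_Y (quintuples_from Q t) y.
  by move=> /weak_prec_pi_Y_quintuples_from[<-|].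
(* If [t] is a successor, the nodes weakly following [t] are closed under predecessors. *)
have back y w : weak_prec Q t y -> pi_YW Q (y, w) -> weak_prec Q t w.
  move=> /YQ Yy yw.
  by have [q [_ tq] [_ <-]] := pi_YW_quintuples_from (Pwy hQ) Yy yw.
have Yt := pi_Y_quintuples_from_subset YTt.
have Tt : weak_prec Q t t by apply: weak_prec_refl; right.
have iter m x : fun_iter (pi_YW Q) m (t, x) -> weak_prec Q t x.
  by elim: m x => [x /= ->//|m IH x [z [/IH + zx]]]; move=> /back; exact.
have [m [x [_ /iter /YQ YTx]]] := Py hQ Yt; apply.
exact: pi_Y_quintuples_from_subset.
Qed.

End QuintuplesFrom.

Theorem proposition4p3 (I J X A : Type) (Q : set (quintuple I J X A)) (t : X)
    (hQ : pentaform Q) (ht : subroots Q t) :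
  pentaform (quintuples_from Q t).
Proof.
have sub := @quintuples_from_subset _ _ _ _ Q t.
split.
- exact: is_function_subset (image_subset sub) (Pij hQ).
- exact: is_function_subset (image_subset sub) (Pjw hQ).
- move=> j Jj; rewrite slice_quintuples_from//.
  exact: Pwa hQ _ (image_subset sub Jj).
- exact: is_function_subset (image_subset sub) (Pway hQ).
- exact: is_function_subset (image_subset sub) (Pwy hQ).
- exact: is_function_subset (image_subset sub) (Pay hQ).
- move=> y Yy; have [m [x [m1 yx nYx]]] := Py hQ (pi_Y_quintuples_from_subset Yy).
  (* An early exit is the goal itself; otherwise [x], lying outside [pi_Y Q], is also outside the
     smaller successor set. *)
  have [Tyx|//] := fun_iter_quintuples_from (Pwy hQ) Yy yx.
  by exists m, x; split=> // Yx; apply: nYx; exact: pi_Y_quintuples_from_subset Yx.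
- exists t; apply/seteqP; split=> [w [[q [_ /= tw] <-] nYw]|_ ->].
    by have [<-|] := weak_prec_pi_Y_quintuples_from tw.
  split; first by apply: pi_W_quintuples_from_root; case: ht.
  exact: root_not_pi_Y_quintuples_from.
Qed.
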